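(* Let $n=2$ and let $\Gamma=(\Gamma^i_{jk})_{i,j,k=1}^2$ be a real trilinear (completely symmetric) tensor. If $\Gamma$ is partially decoupleable, then $\Gamma$ is fully decoupleable. That is, $\mathcal{T}_{2,\mathrm{PD}}=\mathcal{T}_{2,\mathrm{FD}}$.
   Context: For $n\ge 2$, $\mathcal{T}_n$ is the set of real $n\times n\times n$ tensors $\Gamma=(\Gamma^i_{jk})$ that are trilinear (completely symmetric), i.e. $\Gamma^i_{jk}=\Gamma^i_{kj}=\Gamma^j_{ik}$ for all $i,j,k$. The orthogonal group $O(n)$ acts on $\mathcal{T}_n$ by $$(\sigma\circ\Gamma)^i_{jk}=\sum_{i',j',k'}\sigma_{ii'}\sigma_{jj'}\sigma_{kk'}\Gamma^{i'}_{j'k'} .$$ $\Gamma$ is fully decoupleable if there is $\sigma\in O(n)$ such that for every $i\in\{1,\dots,n\}$ we have $(\sigma\circ\Gamma)^i_{jk}=0$ for all $(j,k)\neq(i,i)$; $\mathcal{T}_{n,\mathrm{FD}}$ is the set of such $\Gamma\in\mathcal{T}_n$. $\Gamma$ is partially decoupleable if there are $\sigma\in O(n)$ and some $i\in\{1,\dots,n\}$ such that $(\sigma\circ\Gamma)^i_{jk}=0$ for all $(j,k)\ne(i,i)$; $\mathcal{T}_{n,\mathrm{PD}}$ is the set of such $\Gamma\in\mathcal{T}_n$. *)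

(* Defs.v *)
From mathcomp Require Import all_boot all_order all_algebra.
From mathcomp Require Import all_classical reals.

Set Implicit Arguments.
Unset Strict Implicit.
Unset Printing Implicit Defensive.

Import Order.TTheory GRing.Theory Num.Theory.
Local Open Scope ring_scope.
Local Open Scope classical_set_scope.

(* G i j k stands for the entry $\Gamma^i_{jk}$. *)
Definition tensor (R : realType) (n : nat) : Type := 'I_n -> 'I_n -> 'I_n -> R.

Definition trilinear (R : realType) (n : nat) (G : tensor R n) : Prop :=
  forall i j k : 'I_n, G i j k = G i k j /\ G i k j = G j i k.

Definition orthogonal_group (R : realType) (n : nat) : set 'M[R]_n :=
  [set s : 'M[R]_n | s^T *m s = 1%:M].
Arguments orthogonal_group : clear implicits.

Definition tensor_act (R : realType) (n : nat) (s : 'M[R]_n) (G : tensor R n) :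
    tensor R n :=
  fun i j k => \sum_(i' < n) \sum_(j' < n) \sum_(k' < n)
    s i i' * s j j' * s k k' * G i' j' k'.

Definition decoupled_at (R : realType) (n : nat) (G : tensor R n) (i : 'I_n) :
    Prop :=
  forall j k : 'I_n, (j, k) <> (i, i) -> G i j k = 0.

Definition fully_decoupleable (R : realType) (n : nat) (G : tensor R n) : Prop :=
  exists2 s : 'M[R]_n, orthogonal_group R n s &
    forall i : 'I_n, decoupled_at (tensor_act s G) i.

Definition partially_decoupleable (R : realType) (n : nat) (G : tensor R n) :
    Prop :=
  exists2 s : 'M[R]_n, orthogonal_group R n s &
    exists i : 'I_n, decoupled_at (tensor_act s G) i.

Definition trilinear_tensors (R : realType) (n : nat) : set (tensor R n) :=
  [set G | trilinear G].
Arguments trilinear_tensors : clear implicits.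

Definition T_FD (R : realType) (n : nat) : set (tensor R n) :=
  [set G | trilinear_tensors R n G /\ fully_decoupleable G].
Arguments T_FD : clear implicits.

Definition T_PD (R : realType) (n : nat) : set (tensor R n) :=
  [set G | trilinear_tensors R n G /\ partially_decoupleable G].
Arguments T_PD : clear implicits.

(* Main.v *)
Require Import Defs.
From mathcomp Require Import all_boot all_order all_algebra.
From mathcomp Require Import all_classical reals.

Import GRing.Theory.
Local Open Scope ring_scope.

(** The action of O(n) preserves complete symmetry, and in a symmetric tensor
    of size two every off-diagonal entry has both indices among its three, so
    it can be read off from the slice of either index. The same orthogonal
    matrix therefore decouples both slices. *)

(** The transpositions of the last two and of the first two indices generate all permutations of
    three indices, so symmetry can be checked one swap at a time. *)
Lemma trilinearP (R : realType) (n : nat) (G : tensor R n) :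
  trilinear G <->
  (forall i j k, G i j k = G i k j) /\ (forall i j k, G i j k = G j i k).
Proof.
split=> [symG | [symr syml] i j k].
  by split=> i j k; have [e1 e2] := symG i j k; rewrite // e1.
by split=> //; rewrite -symr syml.
Qed.

(** Swapping two indices of the image amounts to exchanging the matching sums and applying the same
    swap to [G]. *)
Lemma trilinear_act (R : realType) (n : nat) (s : 'M[R]_n) (G : tensor R n) :
  trilinear G -> trilinear (tensor_act s G).
Proof.
move=> /trilinearP[symr syml]; apply/trilinearP; split=> i j k; rewrite /tensor_act.
  apply: eq_bigr => i' _; rewrite exchange_big /=.
  apply: eq_bigr => k' _; apply: eq_bigr => j' _.
  by rewrite symr (mulrAC (s i i')).
rewrite exchange_big /=; apply: eq_bigr => j' _; apply: eq_bigr => i' _.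
by apply: eq_bigr => k' _; rewrite syml (mulrC (s i i')).
Qed.

Lemma ord2_neq_eq (i j k : 'I_2) : j != i -> k != j -> k = i.
Proof.
move=> ji kj; apply/val_inj; move: ji kj; rewrite -!val_eqE /=.
by case: i j k => [[|[|?]] ?] [[|[|?]] ?] [[|[|?]] ?].
Qed.

Lemma decoupled_at_ord2 (R : realType) (G : tensor R 2) (i j : 'I_2) :
  trilinear G -> decoupled_at G i -> decoupled_at G j.
Proof.
move=> /trilinearP[symr syml] Gi; have [-> // | ji] := eqVneq j i.
(* Symmetry moves this entry into slice [i], where [j != i] places it off the diagonal. *)
have Gij k : G j i k = 0 by rewrite -syml; apply: Gi => -[/eqP]; rewrite (negPf ji).
move=> k l /eqP; rewrite xpair_eqE negb_and => /orP[kj | lj].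
  by rewrite (ord2_neq_eq _ _ _ ji kj).
by rewrite symr (ord2_neq_eq _ _ _ ji lj).
Qed.

Theorem lemma2p1 (R : realType) :
  (forall G : tensor R 2,
     trilinear G -> partially_decoupleable G -> fully_decoupleable G) /\
  T_PD R 2 = T_FD R 2.
Proof.
have PD_FD (G : tensor R 2) :
    trilinear G -> partially_decoupleable G -> fully_decoupleable G.
  move=> symG [s Os [i Gi]]; exists s => // j.
  by apply: decoupled_at_ord2 Gi; apply: trilinear_act.
split=> //; apply/seteqP; split=> G [symG dG]; split=> //; first exact: PD_FD.
(* Every slice is decoupled, so any index serves as witness. *)
by have [s Os FD] := dG; exists s => //; exists ord0.
Qed.
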